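(* Let $F_2=F(a,b)$ be the free group on $\{a,b\}$. Let $\sigma\in \mathrm{Aut}(F_2)$ be any length-preserving automorphism having no non-trivial fixed points (i.e. $w^\sigma\neq w$ for all $w\in F_2$, $w\ne 1$). Let $w_a,w_b\in F_2$ be arbitrary elements for which the words $a\,w_a\,a$ and $b\,w_b\,b$ are reduced as written, and suppose that $\tau:F_2\to F_2$ given by $a\mapsto a\,w_a\,a$, $b\mapsto b\,w_b\,b$ is a monomorphism. Then for all nontrivial finitely generated subgroups $H,K\leqslant F_2$, either the pair $H,K$ or the pair $H^{\tau\sigma},K$ satisfies the Hanna Neumann conjecture, i.e. at least one of the following holds: $$\mathrm{rank}(H\cap K)-1\leqslant[\mathrm{rank}(H)-1][\mathrm{rank}(K)-1],$$ $$\mathrm{rank}(H^{\tau\sigma}\cap K)-1\leqslant[\mathrm{rank}(H^{\tau\sigma})-1][\mathrm{rank}(K)-1].$$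
   Context: Homomorphisms are written as exponents and act on the right: $u^{\phi}$ is the image of $u$ under $\phi$, $H^\phi$ is the image of the subgroup $H$, and $H^{\tau\sigma}=(H^\tau)^\sigma$. For $u$ in a free group, $|u|$ is the length of the reduced word representing $u$. An automorphism $\sigma$ of $F(X)$ is length-preserving if $|u^\sigma|=|u|$ for all $u$, equivalently $(X^{\pm})^\sigma=X^{\pm}$ where $X^\pm=X\cup X^{-1}$. The words $w_a,w_b$ are written as reduced words (possibly empty). The rank of a free group is the size of a basis; the trivial group has rank $0$. *)

(* Defs.v *)
From HB Require Import structures.
From mathcomp Require Import all_boot all_order all_algebra.
From mathcomp Require Import boolp classical_sets.

Set Implicit Arguments.
Unset Strict Implicit.
Unset Printing Implicit Defensive.

Local Open Scope group_scope.
Local Open Scope classical_set_scope.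

(* The free group on [T] is the type of reduced words; the letter [(x, false)]
   stands for x and [(x, true)] for its inverse. *)
Section Words.
Variable T : choiceType.
Implicit Types (l : T * bool) (u v w : seq (T * bool)).

Definition linv l := (l.1, ~~ l.2).

Definition reduced w := sorted [rel l m | m != linv l] w.

Definition lcons l w :=
  if w is m :: w' then if m == linv l then w' else l :: w else [:: l].

Definition reduce w := foldr lcons [::] w.

Definition winv w := rev (map linv w).

Lemma linvK : involutive linv.
Proof. by case=> x b; rewrite /linv /= negbK. Qed.

Lemma lcons_reduced l w : reduced w -> reduced (lcons l w).
Proof.
case: w => [|m w] //=; case: ifPn => [_|nm]; first exact: path_sorted.
by move=> /= ->; rewrite nm.
Qed.

Lemma reduce_reduced w : reduced (reduce w).
Proof. by elim: w => //= l w; apply: lcons_reduced. Qed.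

Lemma lcons_id l w : reduced (l :: w) -> lcons l w = l :: w.
Proof. by case: w => [|m w] //= /andP[/negPf ->]. Qed.

Lemma reduce_id w : reduced w -> reduce w = w.
Proof.
elim: w => // l w IHw rlw.
by rewrite /= IHw ?lcons_id //; apply: path_sorted rlw.
Qed.

Lemma lconsK l w : reduced w -> lcons l (lcons (linv l) w) = w.
Proof.
case: w => [|m w] rw /=; first by rewrite eqxx.
rewrite linvK; case: ifPn => [/eqP ml|_] /=; last by rewrite eqxx.
by rewrite -ml lcons_id.
Qed.

Lemma foldr_lcons_reduced u w : reduced w -> reduced (foldr lcons w u).
Proof. by move=> rw; elim: u => //= l u; apply: lcons_reduced. Qed.

Lemma foldr_lcons l v w :
  reduced w -> foldr lcons w (lcons l v) = lcons l (foldr lcons w v).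
Proof.
move=> rw; case: v => [|m v] //=; case: ifP => //= /eqP ->.
by rewrite lconsK //; apply: foldr_lcons_reduced.
Qed.

Lemma foldr_reduce u w : reduced w -> foldr lcons w (reduce u) = foldr lcons w u.
Proof. by move=> rw; elim: u => //= l u IHu; rewrite foldr_lcons // IHu. Qed.

Lemma reduce_cat u v : reduce (u ++ v) = foldr lcons (reduce v) u.
Proof. exact: foldr_cat. Qed.

Lemma reduce_catl u v : reduce (reduce u ++ v) = reduce (u ++ v).
Proof. by rewrite !reduce_cat foldr_reduce // reduce_reduced. Qed.

Lemma reduce_catr u v : reduce (u ++ reduce v) = reduce (u ++ v).
Proof. by rewrite !reduce_cat (reduce_id (reduce_reduced v)). Qed.

Lemma winvK : involutive winv.
Proof. by move=> w; rewrite /winv map_rev revK (mapK linvK). Qed.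

Lemma winv_reduced w : reduced w -> reduced (winv w).
Proof.
rewrite /winv /reduced rev_sorted sorted_map; apply: sub_sorted => l m /=.
by apply: contraNneq => ->; rewrite linvK.
Qed.

Lemma reduce_winvl w : reduce (winv w ++ w) = [::].
Proof.
elim: w => // l w IHw.
rewrite /winv /= rev_cons cat_rcons reduce_cat /=.
have := @lconsK (linv l) _ (reduce_reduced w); rewrite linvK => ->.
by rewrite -reduce_cat.
Qed.

End Words.

Record freeGroup (T : choiceType) :=
  FreeWord { fword :> seq (T * bool); _ : reduced fword }.

Section FreeGroup.
Variable T : choiceType.

HB.instance Definition _ := [isSub for @fword T].
HB.instance Definition _ := [Choice of freeGroup T by <:].

Definition free_mul (u v : freeGroup T) := FreeWord (reduce_reduced (u ++ v)).
Definition free_one := @FreeWord T [::] isT.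
Definition free_inv (u : freeGroup T) := FreeWord (winv_reduced (valP u)).

Fact free_mulA : associative free_mul.
Proof.
by move=> u v w; apply: val_inj; rewrite /= reduce_catl reduce_catr catA.
Qed.

Fact free_mul1g : left_id free_one free_mul.
Proof. by move=> u; apply: val_inj; rewrite /= reduce_id //; apply: valP. Qed.

Fact free_mulg1 : right_id free_one free_mul.
Proof. by move=> u; apply: val_inj; rewrite /= cats0 reduce_id //; apply: valP. Qed.

Fact free_mulVg : left_inverse free_one free_inv free_mul.
Proof. by move=> u; apply: val_inj; rewrite /= reduce_winvl. Qed.

Fact free_mulgV : right_inverse free_one free_inv free_mul.
Proof.
by move=> u; apply: val_inj; rewrite /= -{1}[fword u]winvK reduce_winvl.
Qed.

HB.instance Definition _ := isGroup.Build (freeGroup T)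
  free_mulA free_mul1g free_mulg1 free_mulVg free_mulgV.

Definition fgen (x : T) : freeGroup T := @FreeWord T [:: (x, false)] isT.

Definition flength (u : freeGroup T) := size (fword u).

End FreeGroup.

Section Subgroups.
Variable G : groupType.

(* The homomorphism from the free group on [T] that sends each generator t to
   [x t]. *)
Definition free_lift (T : choiceType) (x : T -> G) (u : freeGroup T) : G :=
  \prod_(l <- fword u) (if l.2 then (x l.1)^-1 else x l.1).

Definition is_subgroup (H : set G) :=
  [/\ H 1, forall x y, H x -> H y -> H (x * y) & forall x, H x -> H x^-1].

Definition generated (A : set G) : set G := smallest is_subgroup A.

Definition finitely_generated (H : set G) :=
  exists s : seq G, H = generated [set x | x \in s].

(* [x] freely generates H: the induced homomorphism from the free group on n
   generators is injective with image H. *)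
Definition is_basis (H : set G) n (x : 'I_n -> G) :=
  injective (free_lift x) /\ range (free_lift x) = H.

(* Finite rank only: no [n] satisfies this when H has infinite rank. *)
Definition has_rank (H : set G) n := exists x : 'I_n -> G, is_basis H x.

(* The ranks are unique by [has_rank_inj]; the inequality includes the claim that
   the intersection has finite rank.  The subtractions are in [int] because the
   trivial group has rank 0. *)
Definition hanna_neumann (H K : set G) :=
  exists m h k : nat,
    [/\ has_rank (H `&` K) m, has_rank H h, has_rank K k &
        (m%:Z - 1 <= (h%:Z - 1) * (k%:Z - 1))%R].

End Subgroups.

Section RankUnique.

Lemma free_lift_reduce (G : groupType) (T : choiceType) (x : T -> G) w :
  \prod_(l <- reduce w) (if l.2 then (x l.1)^-1 else x l.1) =
  \prod_(l <- w) (if l.2 then (x l.1)^-1 else x l.1).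
Proof.
elim: w => //= l w; rewrite big_cons => <-.
case: (reduce w) => [|m v] /=; first by rewrite big_cons.
case: ifP => [/eqP ->|_]; last by rewrite big_cons.
by rewrite big_cons /=; case: l.2; rewrite /= ?mulKg ?mulVKg.
Qed.

Lemma free_liftM (G : groupType) (T : choiceType) (x : T -> G) :
  {morph free_lift x : u v / u * v}.
Proof. by move=> u v; rewrite /free_lift free_lift_reduce big_cat. Qed.

Lemma free_lift_gen (G : groupType) (T : choiceType) (x : T -> G) t :
  free_lift x (fgen t) = x t.
Proof. by rewrite /free_lift big_seq1. Qed.

Lemma free_lift1 (G : groupType) (T : choiceType) (x : T -> G) :
  free_lift x 1 = 1.
Proof. by rewrite /free_lift big_nil. Qed.

Lemma free_liftV (G : groupType) (T : choiceType) (x : T -> G) :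
  {morph free_lift x : u / u^-1}.
Proof.
move=> u; apply: (@mulgI G (free_lift x u)).
by rewrite -free_liftM !mulgV free_lift1.
Qed.

Lemma free_lift_comp (G : groupType) (S T : choiceType) (x : T -> G)
    (u : S -> freeGroup T) v :
  free_lift x (free_lift u v) = free_lift (free_lift x \o u) v.
Proof.
rewrite {2}/free_lift (big_morph _ (free_liftM x) (free_lift1 x)).
by apply: eq_bigr => -[t []] _ //=; rewrite free_liftV.
Qed.

(* The image of a word under the homomorphism to Z/2 given by [c]. *)
Let par (T : choiceType) (c : T -> bool) (w : seq (T * bool)) : bool :=
  \big[addb/false]_(l <- w) c l.1.

Let par_reduce (T : choiceType) (c : T -> bool) w : par c (reduce w) = par c w.
Proof.
rewrite /par; elim: w => //= l w; rewrite big_cons => <-.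
case: (reduce w) => [|m v] /=; first by rewrite big_cons.
case: ifP => [/eqP ->|_]; last by rewrite big_cons.
by rewrite big_cons /= addKb.
Qed.

Let par_lift (S T : choiceType) (c : T -> bool) (u : S -> freeGroup T) v :
  par c (free_lift u v) = par (fun s => par c (u s)) v.
Proof.
have parM : {morph (fun w : freeGroup T => par c w) : w1 w2 / w1 * w2 >-> w1 (+) w2}.
  by move=> w1 w2; rewrite par_reduce /par big_cat.
have par1 : par c (1 : freeGroup T) = false by rewrite /par big_nil.
have parV (w : freeGroup T) : par c w^-1 = par c w.
  by apply: (@addbI (par c w)); rewrite -(parM w w^-1) mulgV par1 addbb.
rewrite /free_lift (big_morph _ parM par1).
by apply: eq_bigr => -[t []] _ //; apply: parV.
Qed.

Lemma has_rank_leq (G : groupType) (H : set G) n m :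
  has_rank H n -> has_rank H m -> n <= m.
Proof.
move=> [x [xI xH]] [y [yI yH]].
have [u uE] : {u : 'I_m -> freeGroup 'I_n & forall j, free_lift x (u j) = y j}.
  apply: (@choice _ _ (fun j w => free_lift x w = y j)) => j.
  have: H (y j) by rewrite -yH; exists (fgen j); rewrite // free_lift_gen.
  by rewrite -xH => -[w _ <-]; exists w.
pose Phi (c : {ffun 'I_n -> bool}) := [ffun j => par c (u j)].
have PhiI : injective Phi.
  move=> c d /ffunP cd; apply/ffunP => i.
  have: H (x i) by rewrite -xH; exists (fgen i); rewrite // free_lift_gen.
  rewrite -yH => -[v _ vE].
  have uv : free_lift u v = fgen i.
    apply: xI; rewrite free_lift_gen free_lift_comp -vE.
    by congr (free_lift _ v); apply: funext.
  have parE e : e i = par (fun j => par e (u j)) v.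
    by rewrite -par_lift uv /par big_seq1.
  rewrite !parE; apply: eq_bigr => l _.
  by have := cd l.1; rewrite !ffunE.
by have := leq_card _ PhiI; rewrite !card_ffun card_bool !card_ord leq_exp2l.
Qed.

Lemma has_rank_inj (G : groupType) (H : set G) n m :
  has_rank H n -> has_rank H m -> n = m.
Proof. by move=> Hn Hm; apply/eqP; rewrite eqn_leq !(@has_rank_leq _ H). Qed.

End RankUnique.

(* The two generators a, b are indexed by [false] and [true]. *)
Notation F2 := (freeGroup bool).
Definition a : F2 := fgen false.
Definition b : F2 := fgen true.

(* Main.v *)
Require Import Defs.
From mathcomp Require Import all_boot all_order all_algebra.
From mathcomp Require Import boolp classical_sets.
From mathcomp Require Import zify.

Set Implicit Arguments.
Unset Strict Implicit.
Unset Printing Implicit Defensive.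

Local Open Scope group_scope.
Local Open Scope classical_set_scope.

(** A nontrivial subgroup H is carried by its core: the finite graph, with
    edges labelled by letters, that is left of the graph of right cosets of H
    when all hanging trees are cut off.  A vertex has at most one outgoing edge
    for each letter; the set of those letters is its star, and the number of
    elements of the star minus two is its excess.  Twice the rank of H minus two
    is the total excess of the core ([rank_core], from [rank_stab]).

    The core of a nontrivial intersection of H and K lies over pairs of core
    vertices of H and K, and the star of a pair is contained in the intersection
    of the two stars.  Hence twice its rank minus two is at most the sum, over all pairs,
    of the truncated excess of the intersection of the stars ([rank_pullback]).
    The conjectured inequality asks for half of the product of the two total
    excesses, that is, half of the sum over all pairs of the products of the
    excesses.  A single pair can violate this: two vertices with three
    directions each have product one, and their stars may coincide.

    Let phi be sigma after tau, and pi the permutation of the four letters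
    induced by sigma.  It fixes no letter, as a fixed letter would be a fixed
    word.  As a wa a begins and ends with a, and similarly for b, the word phi(l)
    begins with pi(l) for every letter l, inverse letters included, and these are
    four different letters.  So subdividing every edge labelled l into a path
    spelling phi(l) turns the core of H into the core of phi(H) without further
    identifications: the stars at the old vertices are permuted by pi, and the
    new vertices have excess zero.  That no identification or new direction
    occurs follows from a count: phi is injective, so H and phi(H) have the same
    rank and their cores the same total excess ([excess_subdivision]).

    Adding the bounds for the pairs H, K and phi(H), K, a pair of stars X, Y
    contributes the excess of the overlap of X and Y plus that of pi(X) and Y.
    Since pi is a derangement of a set of four elements, this is at most the
    product of the excesses of X and Y ([excess_derangement]).  The two bounds
    therefore add up to at most the full product, and one of them is at most
    half of it. *)

(** * Words and homomorphisms of free groups *)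

Section FreeWords.
Variable T : choiceType.
Implicit Types (l : T * bool) (u v : freeGroup T) (w : seq (T * bool)).

Definition word w : freeGroup T := FreeWord (reduce_reduced w).

Definition letter l : freeGroup T := @FreeWord T [:: l] isT.

Lemma linv_neq l : linv l <> l.
Proof. by case: l => x [] []. Qed.

Lemma reduced_fword u : reduced (fword u).
Proof. exact: valP. Qed.

Lemma fword_inj : injective (@fword T).
Proof. exact: val_inj. Qed.

Lemma word_fword u : word (fword u) = u.
Proof. by apply: fword_inj; rewrite /= reduce_id // reduced_fword. Qed.

Lemma word_cons l w : word (l :: w) = letter l * word w.
Proof. by apply: fword_inj; rewrite /= (reduce_id (reduce_reduced w)). Qed.

Lemma letterV l : letter (linv l) = (letter l)^-1.
Proof. exact: fword_inj. Qed.

Lemma letter_inj : injective letter.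
Proof. by move=> l m [->]. Qed.

Section Morphism.
Variables (G : groupType) (phi : freeGroup T -> G).
Hypothesis phiM : {morph phi : u v / u * v}.

Lemma morph1 : phi 1 = 1.
Proof. by apply: (@mulgI G (phi 1)); rewrite -phiM !mulg1. Qed.

Lemma morphV : {morph phi : u / u^-1}.
Proof. by move=> u; apply: (@mulgI G (phi u)); rewrite -phiM !mulgV morph1. Qed.

End Morphism.

Lemma fword_morph (T' : choiceType) (phi : freeGroup T -> freeGroup T') u :
  {morph phi : u v / u * v} ->
  fword (phi u) = reduce (flatten [seq fword (phi (letter l)) | l <- fword u]).
Proof.
move=> phiM; rewrite -{1}[u]word_fword; elim: (fword u) => [|l w IHw].
  by rewrite [word _](_ : _ = 1) ?(morph1 phiM) //; apply: fword_inj.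
by rewrite word_cons phiM /= IHw reduce_catr.
Qed.

End FreeWords.

Arguments letter {T}.

Lemma free_lift_letter (G : groupType) (T : choiceType) (x : T -> G) l :
  free_lift x (letter l) = if l.2 then (x l.1)^-1 else x l.1.
Proof. by rewrite /free_lift big_seq1. Qed.

Lemma has_rank_image (G G' : groupType) (f : G -> G') (H : set G) n :
  {morph f : x y / x * y} -> injective f -> has_rank H n ->
  has_rank (f @` H) n.
Proof.
move=> fM fI [x [xI xH]]; exists (f \o x).
have f1 : f 1 = 1 by apply: (@mulgI _ (f 1)); rewrite -fM !mulg1.
have fV : {morph f : y / y^-1}.
  by move=> y; apply: (@mulgI _ (f y)); rewrite -fM !mulgV.
have liftE u : free_lift (f \o x) u = f (free_lift x u).
  rewrite /free_lift (big_morph _ fM f1).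
  by apply: eq_bigr => -[i []] _ //=; rewrite fV.
split=> [u v|]; first by rewrite !liftE => /fI/xI.
rewrite -xH; apply/seteqP; split=> [_ [u _ <-]|_ [_ [u _ <-] <-]].
  by rewrite liftE; exists (free_lift x u) => //; exists u.
by exists u; rewrite // liftE.
Qed.

Lemma has_rank_trivial (G : groupType) : has_rank [set 1 : G] 0.
Proof.
have one (u : freeGroup 'I_0) : u = 1.
  by apply: fword_inj; case: u => -[|[[]//]].
exists (fun=> 1); split=> [u v _|]; first by rewrite (one u) (one v).
apply/seteqP; split=> [_ [u _ <-]|_ ->]; last by exists 1; rewrite // free_lift1.
by rewrite (one u) free_lift1.
Qed.

(** * Coverings of the rose *)

(** A graph with exactly one edge out of each vertex for every letter, inverse
    letters giving inverse edges.  Since steps are total, walking is an action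
    of the free group; finite graphs enter as finite sets of vertices with all
    the edges between them. *)
Record covering (T : choiceType) := Covering {
  vertex :> choiceType;
  step : vertex -> T * bool -> vertex;
  _ : forall v l, step (step v l) (linv l) = v }.

Section Walk.
Variables (T : choiceType) (S : covering T).
Implicit Types (v : S) (l : T * bool) (w : seq (T * bool)) (V : seq S).
Implicit Types (x y : freeGroup T).

Lemma stepK v l : step (step v l) (linv l) = v.
Proof. by case: S v => V s sK v; apply: sK. Qed.

Lemma stepVK v l : step (step v (linv l)) l = v.
Proof. by rewrite -{2}[l]linvK stepK. Qed.

Definition walk v w := foldl (@step T S) v w.

Lemma walk_cat v w w' : walk v (w ++ w') = walk (walk v w) w'.
Proof. exact: foldl_cat. Qed.

Lemma walk_lcons v l w : walk v (lcons l w) = walk (step v l) w.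
Proof. by case: w => //= m w; case: ifP => //= /eqP->; rewrite stepK. Qed.

Lemma walk_reduce v w : walk v (reduce w) = walk v w.
Proof. by elim: w v => //= l w IHw v; rewrite walk_lcons IHw. Qed.

Lemma walkM v x y : walk v (x * y : freeGroup T) = walk (walk v x) y.
Proof. by rewrite -walk_cat -[RHS]walk_reduce. Qed.

Lemma walkK v x : walk (walk v x) (x^-1 : freeGroup T) = v.
Proof. by rewrite -walkM mulgV. Qed.

Definition stab v : set (freeGroup T) := [set x | walk v (fword x) = v].

Fixpoint inside V v w :=
  (v \in V) && (if w is l :: w' then inside V (step v l) w' else true).

Lemma inside_start V v w : inside V v w -> v \in V.
Proof. by case: w => [|l w] /= /andP[]. Qed.

Lemma inside_cat V v w w' :
  inside V v (w ++ w') = inside V v w && inside V (walk v w) w'.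
Proof.
elim: w v => [|l w IHw] v /=; last by rewrite IHw andbA.
rewrite andbT; case: (boolP (v \in V)) => //= nV.
by apply/negbTE; apply: contra nV => /inside_start.
Qed.

Lemma inside_end V v w : inside V v w -> walk v w \in V.
Proof. by rewrite -[w]cats0 inside_cat cats0 => /andP[_ /inside_start]. Qed.

(** Cancelling a pair of inverse letters only removes an excursion, so it keeps
    a walk inside V. *)
Lemma inside_reduce V v w : inside V v w -> inside V v (reduce w).
Proof.
elim: w v => //= l w IHw v /andP[Vv /IHw].
case: (reduce w) => [|m u] /=; first by rewrite Vv.
case: ifP => [/eqP->|_] /andP[Vl uV] /=; last by rewrite Vv Vl uV.
by rewrite stepK in uV.
Qed.

Lemma inside_winv V v w : inside V v w -> inside V (walk v w) (winv w).
Proof.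
elim: w v => //= l w IHw v /andP[Vv wV].
rewrite /winv /= rev_cons -cats1 inside_cat -/(winv w) IHw //=.
have -> : walk (walk (step v l) w) (winv w) = step v l.
  by rewrite -walk_cat -walk_reduce -[w in w ++ _]winvK reduce_winvl.
by rewrite stepK Vv (inside_start wV).
Qed.

Lemma insideP V v w :
  (forall p q, w = p ++ q -> walk v p \in V) -> inside V v w.
Proof.
elim: w v => [|l w IHw] v prefV /=; first by rewrite (prefV [::] [::]).
rewrite (prefV [::] (l :: w)) //= IHw // => p q wpq.
by apply: (prefV (l :: p) q); rewrite wpq.
Qed.

(** The reduced loops of the covering based in a convex V lie in V, so the
    stabilizer of a vertex is the fundamental group of the graph V.  The first
    clause places V in one component; with the second, V is connected. *)
Definition convex V :=
  (forall v v', v \in V -> v' \in V -> exists x, walk v (fword x) = v') /\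
  (forall v x, v \in V -> walk v (fword x) \in V -> inside V v (fword x)).

Lemma stab_conj v x : stab v = [set y ^ x^-1 | y in stab (walk v (fword x))].
Proof.
have stabJ y v' z : walk v' (fword y) = v' ->
    walk (walk v' (fword z)) (fword (y ^ z)) = walk v' (fword z).
  by move=> yv'; rewrite -walkM conjgE mulVKg walkM yv'.
apply/seteqP; split=> [y yv|_ [y yv <-]] /=.
  by exists (y ^ x); [apply: stabJ | rewrite conjgK].
by rewrite /stab /= -[in RHS](walkK v x) -{1}(walkK v x); apply: stabJ.
Qed.

End Walk.

Arguments convex {T S}.
Arguments inside {T S}.
(** * Cores *)

Section Core.
Variables (T : finType) (S : covering T).
Implicit Types (v : S) (l : T * bool) (V C U : seq S) (x : freeGroup T).

Definition star V v : {set T * bool} := [set l | step v l \in V]%SET.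

Definition leafless V := forall v, v \in V -> (2 <= #|star V v|)%N.

Lemma starS V V' v : {subset V <= V'} -> star V v \subset star V' v.
Proof. by move=> sV; apply/fintype.subsetP => l; rewrite !inE; apply: sV. Qed.

Lemma card_ge2 (A : finType) (X : {set A}) i j :
  i \in X -> j \in X -> i <> j -> (2 <= #|X|)%N.
Proof.
move=> iX jX /eqP ij.
have {ij} <- : #|[set i; j]%SET| = 2%N by rewrite cards2 ij.
apply: fintype.subset_leq_card; apply/fintype.subsetP => k.
by rewrite !inE => /orP[]/eqP->.
Qed.

(** A reduced word cannot enter and leave a leaf, so pruning leaves preserves
    convexity. *)
Lemma inside_prune V v v' w :
  (#|star V v| < 2)%N -> reduced w -> inside V v' w ->
  v' != v -> walk v' w != v -> inside [seq z <- V | z != v] v' w.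
Proof.
move=> leaf; elim: w v' => [|l w IHw] v' /= rw /andP[Vv' wV] nv nw.
  by rewrite mem_filter nv Vv'.
rewrite mem_filter nv Vv' /=; have rw' := path_sorted rw.
case: (eqVneq (step v' l) v) => [lv|/IHw]; last exact.
case: w {IHw} rw wV nw rw' => [|m w] /=; first by rewrite lv eqxx.
move=> /andP[ml _]; rewrite lv => /andP[_ mV] _ _.
move: leaf; rewrite ltnNge => /negP[].
apply: (@card_ge2 _ _ m (linv l)); last exact/eqP.
  by rewrite inE (inside_start mV).
by rewrite inE -lv stepK.
Qed.

Lemma convex_prune V v :
  (#|star V v| < 2)%N -> convex V -> convex [seq z <- V | z != v].
Proof.
move=> leaf [orbV convV]; split=> [z z'|z x]; rewrite !mem_filter.
  by move=> /andP[_ Vz] /andP[_ Vz']; apply: orbV.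
move=> /andP[nz Vz] /andP[nx Vx].
by apply: inside_prune => //; [apply: reduced_fword | apply: convV].
Qed.

(** [core_max] compares the cores of two graphs when one graph maps to the
    other: the image of a leafless set is leafless. *)
Record is_core V C : Prop := IsCore {
  core_uniq : uniq C;
  core_sub : {subset C <= V};
  core_convex : convex C;
  core_leafless : leafless C;
  core_inhabited : exists c, c \in C;
  core_max : forall U, {subset U <= V} -> leafless U -> {subset U <= C} }.

(** Leaves are pruned until none remains.  A loop at v carries a loop at each
    neighbour, so the process stops before the empty set; a leafless subset
    never loses a vertex. *)
Lemma exists_core V v x :
  uniq V -> convex V -> v \in V -> x <> 1 -> walk v (fword x) = v ->
  exists C, is_core V C.
Proof.
have [n] := ubnP (size V); elim: n => // n IHn in V v x *.
move=> ltVn uV cV Vv x1 xv.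
have [lfV|/existsNP[z /not_implyP[Vz /negP]]] := pselect (leafless V).
  by exists V; split=> //; exists v.
rewrite -ltnNge => leaf; set V' := [seq y <- V | y != z].
have sV' : {subset V' <= V} by move=> y; rewrite mem_filter => /andP[].
have [v' [x' [Vv' x1' xv']]] :
    exists v', exists x', [/\ v' \in V', x' <> 1 & walk v' (fword x') = v'].
  have [zv|nvz] := eqVneq v z; last by exists v, x; rewrite mem_filter nvz.
  have := cV.2 _ x Vv; rewrite xv => /(_ Vv).
  case Ex: (fword x) => [|l w] /=; first by case: x1; apply: fword_inj.
  move=> /andP[_ /inside_start lV]; exists (step v l), (x ^ letter l).
  split=> [||]; last 1 first.
  - have stepE z' : step z' l = walk z' (fword (letter l)) by [].
    by rewrite stepE -walkM conjgE mulVKg walkM xv.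
  - rewrite mem_filter lV andbT -zv; apply/eqP => lv.
    move: leaf; rewrite ltnNge => /negP[].
    apply: (@card_ge2 _ _ (linv l) l); last exact: linv_neq.
      by rewrite inE -zv -[in step _ _]lv stepK.
    by rewrite inE -zv lv.
  - by move/eqP; rewrite conjg_eq1 => /eqP.
have ltV'n : (size V' < n)%N.
  rewrite size_filter -ltnS; apply: leq_trans ltVn; rewrite ltnS.
  rewrite -(count_predC (pred1 z) V) addnC -addn1 leq_add2l.
  by rewrite -has_count has_pred1.
have [C [uC sC cC lC neC maxC]] :=
  IHn V' v' x' ltV'n (filter_uniq _ uV) (convex_prune leaf cV) Vv' x1' xv'.
exists C; split=> // [y /sC/sV'//|U sU lU].
apply: maxC => // y Uy; rewrite mem_filter (sU _ Uy) andbT.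
apply: contraL leaf => /eqP <-; rewrite -leqNgt.
by apply: leq_trans (lU _ Uy) (fintype.subset_leq_card (starS y sU)).
Qed.

End Core.
(** * The rank of the stabilizer of a vertex *)

Section Rank.
Variables (T : finType) (t0 : T) (S : covering T) (V : seq S) (v0 : S).
Hypotheses (uV : uniq V) (cV : convex V) (Vv0 : v0 \in V).
Implicit Types (v : S) (l : T * bool) (t : T) (e : S * T).

(** A breadth-first spanning tree, with d the distance to v0: a shortest word
    from v0 to v stays in V, and [up v] is its last letter.  The letter
    (t0, true) is a default value. *)
Lemma exists_bfs : exists (d : S -> nat) (up : S -> T * bool),
  forall v, v \in V -> v <> v0 ->
    step v (linv (up v)) \in V /\ (d (step v (linv (up v))) < d v)%N.
Proof.
have reach v : exists n, `[< v \in V -> exists2 x : freeGroup T,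
    walk v0 (fword x) = v & size (fword x) = n >].
  have [Vv|nV] := boolP (v \in V); last by exists 0%N; apply/asboolP.
  have [x xv] := cV.1 _ _ Vv0 Vv.
  by exists (size (fword x)); apply/asboolP; exists x.
pose d v := ex_minn (reach v).
suff /choice[up upP] : forall v, exists l, v \in V -> v <> v0 ->
    step v (linv l) \in V /\ (d (step v (linv l)) < d v)%N.
  by exists d, up.
move=> v; have [Vv|nV] := boolP (v \in V); last by exists (t0, true).
have [x xv dx] : exists2 x : freeGroup T,
    walk v0 (fword x) = v & size (fword x) = d v.
  by rewrite /d; case: ex_minnP => n /asboolP/(_ Vv).
have inx : inside V v0 (fword x) by apply: cV.2 => //; rewrite xv.
case/lastP Ex: (fword x) => [|w l].
  by exists (t0, true) => _ []; rewrite -xv Ex.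
have vE : step v (linv l) = walk v0 w.
  by rewrite -xv Ex -cats1 walk_cat /= stepK.
move: inx; rewrite Ex -cats1 inside_cat => /andP[/inside_end Vw _].
exists l => _ _; rewrite vE; split=> //.
rewrite -dx Ex size_rcons ltnS {1}/d; case: ex_minnP => n _; apply.
apply/asboolP => _; exists (word w); first by rewrite walk_reduce.
rewrite /= reduce_id //; have := reduced_fword x.
by rewrite Ex /reduced -cats1 => /cat_sorted2[].
Qed.

Section Tree.
Variables (d : S -> nat) (up : S -> T * bool).
Hypothesis upP : forall v, v \in V -> v <> v0 ->
  step v (linv (up v)) \in V /\ (d (step v (linv (up v))) < d v)%N.

Let parent v := step v (linv (up v)).

(* Edges are listed once, as their source and a positive letter. *)
Let tree_edge v := (if (up v).2 then v else parent v, (up v).1).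

Let edges := [seq e <- [seq (v, t) | v <- V, t <- enum T] |
               step e.1 (e.2, false) \in V].
Let tree := [seq tree_edge v | v <- V & v != v0].
Let cotree := [seq e <- edges | e \notin tree].

Lemma mem_edges v t : ((v, t) \in edges) = (v \in V) && (step v (t, false) \in V).
Proof.
rewrite mem_filter /= andbC; congr (_ && _).
apply/allpairsP/idP => [[[w s] /= [Vw _ [-> _]]] //|Vv].
by exists (v, t); rewrite mem_enum.
Qed.

Lemma edges_uniq : uniq edges.
Proof.
apply: filter_uniq; apply: allpairs_uniq => //; first exact: enum_uniq.
by move=> [? ?] [? ?].
Qed.

(** Two vertices cannot be each other's parent, since depth decreases. *)
Lemma tree_uniq : uniq tree.
Proof.
rewrite map_inj_in_uniq ?filter_uniq // => v w.
rewrite !mem_filter => /andP[/eqP nv Vv] /andP[/eqP nw Vw].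
have [[_ dv] [_ dw]] := (upP Vv nv, upP Vw nw).
rewrite /tree_edge /parent; move: dv dw.
case: (up v) (up w) => t [] [s []] /= dv dw [] // vE st; subst s.
- by move: dv; rewrite vE stepVK in dw * => /(ltn_trans dw); rewrite ltnn.
- by move: dw; rewrite -vE stepVK in dv * => /(ltn_trans dv); rewrite ltnn.
- by rewrite -(stepVK v (t, false)) /linv /= vE (stepVK w (t, false)).
Qed.

Lemma sub_tree_edges : {subset tree <= edges}.
Proof.
move=> e /mapP[v]; rewrite mem_filter => /andP[/eqP nv Vv] -> {e}.
have [Vp _] := upP Vv nv; rewrite /tree_edge /parent mem_edges.
move: Vp; case: (up v) => t [] /= Vp; rewrite Vp ?Vv //=.
by rewrite (stepVK v (t, false)).
Qed.

Lemma size_cotree : (size cotree + size V = (size edges).+1)%N.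
Proof.
have sz : (size cotree + size tree = size edges)%N.
  rewrite size_filter -(count_predC (mem tree) edges) addnC.
  congr (_ + _)%N; rewrite -size_filter; apply/perm_size.
  apply: uniq_perm; [exact: tree_uniq | exact: filter_uniq edges_uniq | move=> e].
  by rewrite mem_filter andb_idr //=; apply: sub_tree_edges.
rewrite -sz size_map size_filter -addnS; congr (_ + _)%N.
rewrite -(count_predC (pred1 v0) V) -add1n; congr (_ + _)%N.
by rewrite count_uniq_mem ?Vv0.
Qed.

Lemma sum_deg : (\sum_(v <- V) #|star V v| = (size edges).*2)%N.
Proof.
have cardE v : #|star V v| =
    (\sum_t (step v (t, false) \in V) + \sum_t (step v (t, true) \in V))%N.
  rewrite -sum1dep_card big_mkcond -big_split /=.
  transitivity (\sum_t \sum_b (step v (t, b) \in V))%N.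
    by rewrite pair_bigA; apply: eq_bigr => -[t b] _ /=; case: ifP.
  by apply: eq_bigr => t _; rewrite big_bool addnC.
under eq_bigr do rewrite cardE; rewrite big_split /=.
have -> : size edges = (\sum_(v <- V) \sum_t (step v (t, false) \in V))%N.
  rewrite size_filter -sum1_count big_mkcond big_allpairs /=.
  apply: eq_bigr => v _; rewrite big_enum /=.
  by apply: eq_bigr => t _; case: ifP.
rewrite -addnn; congr (_ + _)%N; rewrite exchange_big [RHS]exchange_big /=.
apply: eq_bigr => t _.
have cnt b : (\sum_(v <- V) (step v (t, b) \in V) =
    size [seq v <- V | step v (t, b) \in V])%N.
  by rewrite size_filter -sum1_count [RHS]big_mkcond; apply: eq_bigr => v; case: ifP.
rewrite !cnt -(size_map (fun v => step v (t, true))).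
apply/perm_size/uniq_perm; rewrite ?filter_uniq //.
  rewrite map_inj_in_uniq ?filter_uniq // => v w _ _ vw.
  by rewrite -(stepK v (t, true)) vw stepK.
move=> v; rewrite mem_filter; apply/mapP/andP => [[w]|[tV Vv]].
  rewrite mem_filter => /andP[Vt Vw] ->; split=> //.
  by rewrite (stepK w (t, true)).
exists (step v (t, false)); last by rewrite (stepK v (t, false)).
by rewrite mem_filter tV (stepK v (t, false)) Vv.
Qed.

(** The element read along the tree from v0 to v; depth bounds the recursion. *)
Lemma exists_root_path : exists P : S -> freeGroup T, P v0 = 1 /\
  forall v, v \in V -> v <> v0 -> P v = P (parent v) * letter (up v).
Proof.
pose path := fix path n v : freeGroup T := if n is n'.+1 then
  if v == v0 then 1 else path n' (parent v) * letter (up v) else 1.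
have pathE n v : v \in V -> (d v < n)%N -> path n v = path (d v).+1 v.
  have [m] := ubnP n; elim: m => // m IHm in n v *.
  case: n => // n; rewrite !ltnS => nm Vv dn /=.
  case: eqP => // nv; have [Vp dp] := upP Vv nv.
  have dp' : (d (parent v) < n)%N by apply: leq_trans dp dn.
  by congr (_ * _); rewrite IHm // [RHS]IHm //; apply: leq_trans nm.
exists (fun v => path (d v).+1 v); split=> [|v Vv nv]; first by rewrite /= eqxx.
have [Vp dp] := upP Vv nv.
by rewrite [LHS]/=; case: eqP => // _; rewrite pathE.
Qed.

Section Basis.
Variable P : S -> freeGroup T.
Hypotheses (P0 : P v0 = 1)
  (PS : forall v, v \in V -> v <> v0 -> P v = P (parent v) * letter (up v)).

Let n := size cotree.

Definition edge_loop v l := P v * letter l * (P (step v l))^-1.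

Let basis (i : 'I_n) :=
  let e := tnth (in_tuple cotree) i in edge_loop e.1 (e.2, false).

Let edge_gen e : freeGroup 'I_n :=
  if insub (index e cotree) is Some i then fgen i else 1.

(** Reading only the edges off the tree along a walk is a crossed homomorphism
    to the free group on those edges; on the stabilizer of v0 it inverts
    [free_lift basis]. *)
Let label v l := if l.2 then (edge_gen (step v l, l.1))^-1 else edge_gen (v, l.1).

Let trace := fix trace v w : freeGroup 'I_n :=
  if w is l :: w' then label v l * trace (step v l) w' else 1.

Lemma edge_gen_basis i : edge_gen (tnth (in_tuple cotree) i) = fgen i.
Proof.
rewrite /edge_gen (tnth_nth (v0, t0)) index_uniq //; first by rewrite valK.
exact: filter_uniq edges_uniq.
Qed.

Lemma edge_gen_tree v : v \in V -> v <> v0 -> edge_gen (tree_edge v) = 1.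
Proof.
move=> Vv nv; rewrite /edge_gen insubF //.
rewrite /n index_mem mem_filter (_ : tree_edge v \in tree = true) //.
by apply: map_f; rewrite mem_filter Vv andbT; apply/eqP.
Qed.

Lemma label_up v : v \in V -> v <> v0 -> label (parent v) (up v) = 1.
Proof.
move=> Vv nv; have := edge_gen_tree Vv nv; rewrite /label /tree_edge /parent.
case: (up v) => t [] /= E; last by rewrite E.
by rewrite (stepVK v (t, true)) E invg1.
Qed.

Lemma label_linv v l : label v l * label (step v l) (linv l) = 1.
Proof. by case: l => t []; rewrite /label /= ?(stepK v (t, _)) ?mulVg ?mulgV. Qed.

Lemma trace_reduce v w : trace v (reduce w) = trace v w.
Proof.
elim: w v => //= l w IHw v; rewrite -IHw; case: (reduce w) => //= m u.
by case: ifP => //= /eqP->; rewrite stepK mulgA label_linv mul1g.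
Qed.

Lemma trace_cat v w w' : trace v (w ++ w') = trace v w * trace (walk v w) w'.
Proof. by elim: w v => [|l w IHw] v /=; rewrite ?mul1g // IHw mulgA. Qed.

Lemma traceM v (x y : freeGroup T) :
  trace v (x * y : freeGroup T) = trace v x * trace (walk v x) y.
Proof. by rewrite -trace_cat -[RHS]trace_reduce. Qed.

Lemma traceV v (x : freeGroup T) :
  trace (walk v x) (x^-1 : freeGroup T) = (trace v x)^-1.
Proof. by apply: (@mulgI _ (trace v x)); rewrite -traceM !mulgV. Qed.

Lemma root_path_spec v : v \in V ->
  walk v0 (fword (P v)) = v /\ trace v0 (fword (P v)) = 1.
Proof.
have [m] := ubnP (d v); elim: m => // m IHm in v *; rewrite ltnS => dm Vv.
have [->|/eqP nv] := eqVneq v v0; first by rewrite P0.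
have [Vp dp] := upP Vv nv.
have [Pp tp] := IHm (parent v) (leq_trans dp dm) Vp.
by rewrite PS // walkM traceM Pp tp /= mul1g mulg1 label_up // stepVK.
Qed.

Lemma edge_loop_linv v l : edge_loop (step v l) (linv l) = (edge_loop v l)^-1.
Proof. by rewrite /edge_loop stepK letterV !invgM invgK mulgA. Qed.

Lemma lift_label v l : v \in V -> step v l \in V ->
  free_lift basis (label v l) = edge_loop v l.
Proof.
have pos w t : w \in V -> step w (t, false) \in V ->
    free_lift basis (edge_gen (w, t)) = edge_loop w (t, false).
  move=> Vw Vwt; rewrite /edge_gen; case: insubP => [i _ iE|].
    have {}iE : nat_of_ord i = index (w, t) cotree := iE.
    rewrite free_lift_gen /basis (tnth_nth (w, t)) /= iE nth_index //.
    by rewrite -index_mem -iE ltn_ord.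
  rewrite index_mem mem_filter mem_edges Vw Vwt !andbT negbK free_lift1.
  move=> /mapP[z]; rewrite mem_filter => /andP[/eqP nz Vz].
  rewrite /tree_edge /edge_loop; have := PS Vz nz.
  rewrite /parent; case: (up z) => s [] /= Pz [wE tE]; subst w s.
    by rewrite Pz (letterV (t, false)) mulgVK mulgV.
  by rewrite (stepVK z (t, false)) -Pz mulgV.
case: l => t [] Vv Vt; rewrite /label /=; last exact: pos.
rewrite free_liftV pos ?(stepK v (t, true)) //.
by apply: invg_inj; rewrite invgK; apply: (edge_loop_linv v (t, true)).
Qed.

Lemma lift_trace v w : inside V v w ->
  free_lift basis (trace v w) = P v * word w * (P (walk v w))^-1.
Proof.
elim: w v => [|l w IHw] v /=.
  by rewrite free_lift1 (_ : word [::] = 1) ?mulg1 ?mulgV //; apply: fword_inj.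
move=> /andP[Vv wV]; rewrite free_liftM lift_label ?IHw ?(inside_start wV) //.
by rewrite /edge_loop word_cons !mulgA mulgVK.
Qed.

Lemma basis_stab i : walk v0 (fword (basis i)) = v0 /\
  trace v0 (fword (basis i)) = fgen i.
Proof.
have : tnth (in_tuple cotree) i \in cotree := mem_tnth i (in_tuple cotree).
rewrite /basis; have := edge_gen_basis i; case: (tnth _ i) => v t gi.
rewrite mem_filter mem_edges => /and3P[_ Vv Vt].
have [[wv tv] [wt tt]] := (root_path_spec Vv, root_path_spec Vt).
have wE : walk v0 (fword (P v * letter (t, false))) = step v (t, false).
  by rewrite walkM wv.
rewrite /edge_loop walkM traceM wE; split.
  by have := walkK v0 (P (step v (t, false))); rewrite wt.
have := traceV v0 (P (step v (t, false))); rewrite wt tt invg1 => ->.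
by rewrite mulg1 traceM tv wv /= mul1g mulg1 /label.
Qed.

Lemma basis_is_basis : is_basis (stab v0) basis.
Proof.
have liftK g : walk v0 (fword (free_lift basis g)) = v0 /\
    trace v0 (fword (free_lift basis g)) = g.
  rewrite -[g]word_fword; elim: (fword g) => [|l w [IHw IHt]].
    by rewrite (_ : word [::] = 1) ?free_lift1 //; apply: fword_inj.
  rewrite word_cons free_liftM walkM traceM free_lift_letter.
  case: l => i b /=; have [wi ti] := basis_stab i; case: b => /=.
    have wVi : walk v0 (fword (basis i)^-1) = v0 by rewrite -[in LHS]wi walkK.
    rewrite wVi IHw IHt -[X in trace X _ * _]wi traceV ti -letterV.
    by split.
  by rewrite wi IHw IHt ti.
split=> [g h gh|].
  by rewrite -[LHS](liftK g).2 gh (liftK h).2.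
apply/seteqP; split=> [_ [g _ <-]|x xv]; first exact: (liftK g).1.
exists (trace v0 (fword x)) => //.
rewrite lift_trace; last by apply: cV.2 => //; rewrite xv.
by rewrite xv P0 invg1 mulg1 mul1g word_fword.
Qed.

End Basis.
End Tree.

(** The fundamental group of a finite graph is free on the edges outside a
    spanning tree, and twice the number of edges is the sum of the degrees. *)
Theorem rank_stab : exists r, has_rank (stab v0) r /\
  (\sum_(v <- V) #|star V v| + 2 = (r + size V).*2)%N.
Proof.
have [d [up upP]] := exists_bfs.
have [P [P0 PS]] := exists_root_path upP.
have := basis_is_basis upP P0 PS; set n := size _ => basisP.
exists n; split; first by eexists; apply: basisP.
by rewrite sum_deg /n (size_cotree upP) doubleS addn2.
Qed.

End Rank.
(** * Graphs of finitely generated subgroups *)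

Section Hull.
Variables (T : finType) (T' : choiceType) (S : covering T) (S' : covering T').
Variables (phi : freeGroup T -> freeGroup T') (f : S -> S').
Hypotheses (phiM : {morph phi : x y / x * y})
  (f_step : forall v l, f (step v l) = walk (f v) (fword (phi (letter l)))).
Implicit Types (V : seq S).

(** The image of the subgraph V when every edge labelled l is subdivided into a
    path spelling [phi l].  Proper prefixes suffice, since a whole word leads to
    the image of the next vertex. *)
Definition hull V : seq S' := undup ([seq f v | v <- V] ++
  flatten [seq [seq walk (f v) (take k (fword (phi (letter l)))) |
    l <- enum (star V v), k <- iota 0 (size (fword (phi (letter l))))] | v <- V]).

Lemma mem_hull V z : z \in hull V <-> (exists2 v, v \in V & z = f v) \/
  exists v l p q, [/\ v \in V, step v l \in V, fword (phi (letter l)) = p ++ q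
    & z = walk (f v) p].
Proof.
rewrite mem_undup mem_cat; split=> [/orP[/mapP|/flatten_mapP[v Vv]]|].
- by left.
- case/allpairsPdep => l [k []]; rewrite mem_enum inE => Vl _ ->; right.
  by exists v, l, (take k (fword (phi (letter l)))), (drop k (fword (phi (letter l))));
    rewrite cat_take_drop.
case=> [[v Vv ->]|[v [l [p [q [Vv Vl pq ->]]]]]]; first by rewrite map_f.
have [q0|nq] := eqVneq q [::].
  by rewrite q0 cats0 in pq; rewrite -pq -f_step map_f.
apply/orP; right; apply/flatten_mapP; exists v => //.
apply/allpairsPdep; exists l, (size p); split.
- by rewrite mem_enum inE.
- by rewrite mem_iota pq size_cat add0n -[X in (X < _)%N]addn0 ltn_add2l lt0n size_eq0.
- by rewrite pq take_size_cat.
Qed.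

Lemma hullS V V' : {subset V <= V'} -> {subset hull V <= hull V'}.
Proof.
move=> sV z /mem_hull zV; apply/mem_hull; case: zV.
  by case=> v /sV Vv ->; left; exists v.
by case=> v [l [p [q [/sV Vv /sV Vl pq ->]]]]; right; exists v, l, p, q.
Qed.

Lemma f_walk v x : f (walk v (fword x)) = walk (f v) (fword (phi x)).
Proof.
rewrite (fword_morph _ phiM) walk_reduce; elim: (fword x) v => //= l w IHw v.
by rewrite walk_cat IHw f_step.
Qed.

Lemma inside_hull V v w : inside V v w ->
  inside (hull V) (f v) (flatten [seq fword (phi (letter l)) | l <- w]).
Proof.
elim: w v => [|l w IHw] v /= /andP[Vv].
  by rewrite andbT => _; apply/mem_hull; left; exists v.
move=> wV; rewrite inside_cat -f_step IHw // andbT.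
apply: insideP => p q pq; apply/mem_hull; right.
by exists v, l, p, q; rewrite (inside_start wV).
Qed.

(** The premise says that every walk of the covering between image vertices
    comes from [phi] up to reduction.  A reduced word between two points of the
    hull is then the reduction of one that retreats to the image of V, crosses
    along the image of a walk in V, and advances; all of this happens inside the
    hull. *)
Lemma convex_hull V : convex V ->
  (forall v w y, v \in V -> w \in V -> walk (f v) (fword y) = f w ->
     exists2 x, phi x = y & walk v (fword x) = w) ->
  convex (hull V).
Proof.
move=> [orbV convV] onto.
have hullP z : z \in hull V -> exists v (x : freeGroup T'),
    [/\ v \in V, inside (hull V) (f v) (fword x) & z = walk (f v) (fword x)].
  move=> /mem_hull[[v Vv ->]|[v [l [p [q [Vv Vl pq ->]]]]]].
    by exists v, 1; rewrite /= andbT; split=> //; apply/mem_hull; left; exists v.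
  exists v, (word p); rewrite /= walk_reduce; split=> //; apply: inside_reduce.
  have : inside V v [:: l] by rewrite /= Vv Vl.
  by move/inside_hull; rewrite /= cats0 pq inside_cat => /andP[].
split=> [z z' /hullP[v [x [Vv xV ->]]] /hullP[v' [x' [Vv' xV' ->]]]|].
  have [y yv] := orbV _ _ Vv Vv'.
  by exists (x^-1 * phi y * x'); rewrite !walkM walkK -f_walk yv.
move=> z y /hullP[v [x [Vv xV ->]]] /hullP[v' [x' [Vv' xV' yE]]].
have [g gE gv] : exists2 g, phi g = x * y * x'^-1 & walk v (fword g) = v'.
  by apply: onto => //; rewrite !walkM yE walkK.
have -> : y = x^-1 * (phi g * x') by rewrite gE mulgVK mulKg.
rewrite /= reduce_catr; apply: inside_reduce.
rewrite inside_cat inside_winv //=.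
have -> : walk (walk (f v) x) (winv x) = f v := walkK _ _.
rewrite inside_cat; apply/andP; split.
  rewrite (fword_morph _ phiM); apply: inside_reduce.
  by apply: inside_hull; apply: convV; rewrite ?gv.
by rewrite -f_walk gv.
Qed.

End Hull.

Lemma cosetsK (T : choiceType) (A : set (freeGroup T)) (l : T * bool) :
  [set x | [set y | A (y * (letter l)^-1)] (x * (letter (linv l))^-1)] = A.
Proof. by apply/seteqP; split=> x; rewrite /= letterV invgK mulgK. Qed.

(** Right multiplication acts on all subsets; the component of a subgroup is its
    graph of right cosets. *)
Definition cosets (T : choiceType) : covering T :=
  @Covering T (set (freeGroup T)) (fun A l => [set y | A (y * (letter l)^-1)])
    (@cosetsK T).

Section Cosets.
Variable T : choiceType.
Implicit Types (A H : set (freeGroup T)) (x : freeGroup T).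

Lemma walk_cosets A x : @walk T (cosets T) A (fword x) = [set y | A (y * x^-1)].
Proof.
rewrite -{2}[x]word_fword; elim: (fword x) A => [|l w IHw] A /=.
  by apply/seteqP; split=> y /=; rewrite (_ : word [::] = 1) ?invg1 ?mulg1 //;
    apply: fword_inj.
by rewrite IHw; apply/seteqP; split=> y /=; rewrite word_cons invgM mulgA.
Qed.

Lemma stab_cosets H : is_subgroup H -> @stab T (cosets T) H = H.
Proof.
case=> H1 HM HV; apply/seteqP; split=> x; rewrite /stab /= walk_cosets.
  by move/seteqP => [_ /(_ _ H1)] /=; rewrite mul1g => /HV; rewrite invgK.
move=> Hx; apply/seteqP; split=> y /= Hy; last by apply: HM => //; apply: HV.
by rewrite -[y](mulgVK x); apply: HM.
Qed.

End Cosets.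

(** Generators of H map a rose with one petal for each generator to the vertex H
    of the coset graph; the hull of its single vertex is the required set. *)
Lemma exists_convex_cosets (T : choiceType) (H : set (freeGroup T)) :
  is_subgroup H -> finitely_generated H ->
  exists V : seq (cosets T), [/\ uniq V, convex V & (H : cosets T) \in V].
Proof.
move=> sH [s Hs]; have [H1 HM HV] := sH.
pose phi := free_lift (fun i : 'I_(size s) => tnth (in_tuple s) i).
have phiM := @free_liftM _ _ (fun i : 'I_(size s) => tnth (in_tuple s) i).
pose pt : covering 'I_(size s) :=
  @Covering _ unit (fun=> fun=> tt) (fun v l => match v with tt => erefl end).
have phiH x : H (phi x).
  rewrite /phi /free_lift; elim: (fword x) => [|l w IHw].
    by rewrite big_nil.
  have Hl : H (tnth (in_tuple s) l.1).
    by rewrite Hs => K [sK Ks]; apply: Ks; apply: (mem_tnth _ (in_tuple s)).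
  by rewrite big_cons; apply: HM => //; case: l.2 => //; apply: HV.
have Hphi y : H y -> exists x, phi x = y.
  rewrite Hs => /(_ [set z | exists x, phi x = z]); apply.
  split=> [|y0 /= /(tnthP (in_tuple s))[i ->]]; last first.
    by exists (fgen i); rewrite /phi free_lift_gen.
  split=> [|_ _ [x <-] [x' <-]|_ [x <-]].
  - by exists 1; rewrite /phi free_lift1.
  - by exists (x * x'); rewrite /phi free_liftM.
  - by exists (x^-1); rewrite /phi free_liftV.
have walkH x : H x <-> @walk T (cosets T) H (fword x) = H.
  by rewrite -{1}(stab_cosets sH).
exists (@hull _ _ pt (cosets T) phi (fun=> H) [:: tt]); split.
- exact: undup_uniq.
- apply: convex_hull => //.
  + by move=> v l; apply/esym/walkH.
  + split=> [[] [] _ _|[] x _ _]; first by exists 1.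
    by apply: insideP => p q _; case: (walk _ _).
  + by move=> [] [] y _ _ /walkH/Hphi[x <-]; exists x => //; case: (walk _ _).
- apply/mem_hull; last by left; exists tt.
  by move=> v l; apply/esym/walkH.
Qed.
(** * Pullbacks *)

(** The truncated subtraction makes the leaves and isolated points of a pullback
    count as zero. *)
Definition excess (A : finType) (X : {set A}) : nat := #|X| - 2.

Section Pullback.
Variables (T : finType) (t0 : T).

Lemma has_rank_stab (S : covering T) (V : seq S) s v x :
  uniq V -> convex V -> v \in V -> walk s (fword x) = v ->
  exists r, has_rank (stab s) r /\
    (\sum_(z <- V) #|star V z| + 2 = (r + size V).*2)%N.
Proof.
move=> uV cV Vv sv; have [r [rk rE]] := rank_stab t0 uV cV Vv.
exists r; split=> //; rewrite (stab_conj s x) sv.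
apply: has_rank_image rk; first by move=> y z; rewrite conjMg.
exact: conjg_inj.
Qed.

Lemma rank_core (S : covering T) (V C : seq S) s :
  convex V -> s \in V -> is_core V C ->
  exists r, has_rank (stab s) r /\
    (\sum_(c <- C) excess (star C c) + 2 = r.*2)%N.
Proof.
move=> cV Vs [uC sC cC lC [c Cc] _].
have [x sx] := cV.1 _ _ Vs (sC _ Cc).
have [r [rk rE]] := has_rank_stab uC cC Cc sx; exists r; split=> //.
suff : (\sum_(z <- C) #|star C z| = \sum_(z <- C) excess (star C z) + 2 * size C)%N.
  by move: rE; lia.
rewrite -sum1_size big_distrr /= -big_split big_seq [RHS]big_seq /=.
by apply: eq_bigr => z Cz; rewrite muln1 subnK // lC.
Qed.

Variables S1 S2 : covering T.

Lemma pullbackK (v : S1 * S2) l :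
  (step (step v.1 l) (linv l), step (step v.2 l) (linv l)) = v.
Proof. by rewrite !stepK; case: v. Qed.

Definition pullback : covering T :=
  @Covering T (S1 * S2)%type (fun v l => (step v.1 l, step v.2 l)) pullbackK.

Lemma walk_pullback v w : @walk T pullback v w = (walk v.1 w, walk v.2 w).
Proof. by elim: w v => [|l w IHw] v /=; [case: v | rewrite IHw]. Qed.

Lemma inside_pullback (V1 : seq S1) (V2 : seq S2) (V : seq pullback) v w :
  (forall x, @walk T pullback v x \in V = (walk v.1 x \in V1) && (walk v.2 x \in V2)) ->
  inside V1 v.1 w -> inside V2 v.2 w -> @inside T pullback V v w.
Proof.
elim: w v => [|l w IHw] v vV /=.
  by have := vV [::]; rewrite /= !andbT => -> -> ->.
move=> /andP[V1v w1] /andP[V2v w2]; rewrite (vV [::]) /= V1v V2v /=.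
by apply: IHw => // x; apply: (vV (l :: x)).
Qed.

Variables (s1 : S1) (s2 : S2).

Definition component (V1 : seq S1) (V2 : seq S2) : seq pullback :=
  [seq v <- [seq (v1, v2) | v1 <- V1, v2 <- V2] |
    `[< exists x, @walk T pullback (s1, s2) (fword x) = v >]].

Lemma mem_component V1 V2 v : v \in component V1 V2 <->
  [/\ v.1 \in V1, v.2 \in V2 & exists x, @walk T pullback (s1, s2) (fword x) = v].
Proof.
rewrite mem_filter; split=> [/andP[/asboolP H]|[? ? ?]].
  by case/allpairsP=> p [p1 p2 vE]; rewrite vE in H *.
apply/andP; split; first exact/asboolP.
by apply/allpairsP; exists v; rewrite -surjective_pairing.
Qed.

Lemma component_uniq V1 V2 : uniq V1 -> uniq V2 -> uniq (component V1 V2).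
Proof.
by move=> u1 u2; apply: filter_uniq; apply: allpairs_uniq => // -[? ?] [? ?].
Qed.

Lemma convex_component V1 V2 : convex V1 -> convex V2 -> convex (component V1 V2).
Proof.
move=> [_ c1] [_ c2]; split=> [v v'|v x].
  move=> /mem_component[_ _ [x xv]] /mem_component[_ _ [x' xv']].
  by exists (x^-1 * x'); rewrite walkM -[in walk v _]xv walkK.
move=> /mem_component[v1 v2 [y yv]] /mem_component[].
rewrite walk_pullback /= => vx1 vx2 _.
apply: (inside_pullback _ (c1 _ _ v1 vx1) (c2 _ _ v2 vx2)) => w.
apply/idP/andP => [/mem_component[]|[w1 w2]]; first by rewrite walk_pullback.
apply/mem_component; rewrite walk_pullback; split=> //.
by exists (y * word w); rewrite walkM yv /= walk_reduce walk_pullback.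
Qed.

Lemma stab_pullback : @stab T pullback (s1, s2) = stab s1 `&` stab s2.
Proof.
by apply/seteqP; split=> x; rewrite /stab /= walk_pullback /= => -[-> ->].
Qed.

(** A leafless subset of the pullback projects to leafless sets, so the core of
    the component of the base point lies over pairs of core vertices, and the
    star of a pair is contained in both stars.  The other components only add
    nonnegative terms. *)
Lemma rank_pullback V1 V2 C1 C2 :
  uniq V1 -> uniq V2 -> convex V1 -> convex V2 -> s1 \in V1 -> s2 \in V2 ->
  is_core V1 C1 -> is_core V2 C2 ->
  exists r, has_rank (stab s1 `&` stab s2) r /\
    (r.*2 <= \sum_(c1 <- C1) \sum_(c2 <- C2)
               excess (star C1 c1 :&: star C2 c2) + 2)%N.
Proof.
move=> u1 u2 cV1 cV2 Vs1 Vs2 core1 core2.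
have [uC1 sC1 cC1 lC1 nC1 maxC1] := core1.
have [uC2 sC2 cC2 lC2 nC2 maxC2] := core2.
have [triv|] := pselect (stab s1 `&` stab s2 = [set 1]).
  by exists 0%N; rewrite triv; split=> //; apply: has_rank_trivial.
move=> ntriv; have [x [x1 xs]] : exists x, x <> 1 /\ (stab s1 `&` stab s2) x.
  apply: contrapT => noloop; apply: ntriv; apply/seteqP; split=> [x xs|_ ->] //.
  by apply: contrapT => x1; apply: noloop; exists x.
have base : (s1, s2) \in component V1 V2.
  by apply/mem_component; split=> //; exists 1.
rewrite -stab_pullback in xs *.
have [W [_ sW _ lW [w Ww] _]] :=
  exists_core (component_uniq u1 u2) (convex_component cV1 cV2) base x1 xs.
have W1 : w.1 \in C1.
  apply: (maxC1 [seq v.1 | v <- W]); last exact: map_f.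
    by move=> _ /mapP[v /sW/mem_component[v1 _ _] ->].
  move=> _ /mapP[v Wv ->]; apply: leq_trans (lW _ Wv) _.
  apply: fintype.subset_leq_card; apply/fintype.subsetP => l; rewrite !inE => Wl.
  by apply/mapP; exists (@step T pullback v l).
have W2 : w.2 \in C2.
  apply: (maxC2 [seq v.2 | v <- W]); last exact: map_f.
    by move=> _ /mapP[v /sW/mem_component[_ v2 _] ->].
  move=> _ /mapP[v Wv ->]; apply: leq_trans (lW _ Wv) _.
  apply: fintype.subset_leq_card; apply/fintype.subsetP => l; rewrite !inE => Wl.
  by apply/mapP; exists (@step T pullback v l).
have [_ _ [y yw]] := (mem_component _ _ _).1 (sW _ Ww).
have Cw : w \in component C1 C2 by apply/mem_component; split=> //; exists y.
have uC := component_uniq uC1 uC2.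
have [r [rk rE]] := has_rank_stab uC (convex_component cC1 cC2) Cw yw.
exists r; split=> //.
have le_star v : (#|star (component C1 C2) v| <=
    excess (star C1 v.1 :&: star C2 v.2) + 2)%N.
  apply: leq_trans (_ : #|star C1 v.1 :&: star C2 v.2| <= _)%N.
    apply: fintype.subset_leq_card; apply/fintype.subsetP => l; rewrite !inE.
    by move=> /mem_component[-> ->].
  by rewrite /excess; lia.
have : (\sum_(v <- component C1 C2) #|star (component C1 C2) v| <=
    \sum_(v <- component C1 C2) excess (star C1 v.1 :&: star C2 v.2) +
      2 * size (component C1 C2))%N.
  rewrite -sum1_size big_distrr /= -big_split; apply: leq_sum => v _.
  by rewrite muln1 le_star.
have : (\sum_(v <- component C1 C2) excess (star C1 v.1 :&: star C2 v.2) <=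
    \sum_(c1 <- C1) \sum_(c2 <- C2) excess (star C1 c1 :&: star C2 c2))%N.
  rewrite -(big_allpairs (F := fun v => excess (star C1 v.1 :&: star C2 v.2))).
  apply: (uniq_sub_le_big leqnn (fun i j => leq_addr j i)) => //.
    by apply: allpairs_uniq => // -[? ?] [? ?].
  by move=> v; rewrite mem_filter => /andP[].
by move: rE; lia.
Qed.

End Pullback.
(** * Subdivisions that permute the directions at a vertex *)

Section Subdivision.
Variables (T T' : finType) (S : covering T) (S' : covering T').
Variables (phi : freeGroup T -> freeGroup T') (f : S -> S').
Hypothesis f_step : forall v l, f (step v l) = walk (f v) (fword (phi (letter l))).
Variable head : T * bool -> T' * bool.
Hypotheses (head_inj : injective head)
  (phi_head : forall l, exists w, fword (phi (letter l)) = head l :: w).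

Lemma star_hull (V : seq S) v :
  v \in V -> head @: star V v \subset star (hull phi f V) (f v).
Proof.
move=> Vv; apply/fintype.subsetP => z /imsetP[l]; rewrite !inE => Vl -> {z}.
have [w lw] := phi_head l; apply/(mem_hull f_step); right.
by exists v, l, [:: head l], w.
Qed.

(** A vertex interior to a subdivided edge has the two directions of that edge,
    which differ because the word along the edge is reduced. *)
Lemma leafless_hull (V : seq S) : leafless V -> leafless (hull phi f V).
Proof.
move=> lV.
have lf v : v \in V -> (2 <= #|star (hull phi f V) (f v)|)%N.
  move=> Vv; apply: leq_trans (lV v Vv) _; rewrite -(card_imset _ head_inj).
  exact: fintype.subset_leq_card (star_hull Vv).
move=> z /(mem_hull f_step)[[v Vv ->]|[v [l [p [q [Vv Vl pq ->]]]]]].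
  exact: lf.
have prefix p' q' : p ++ q = p' ++ q' -> walk (f v) p' \in hull phi f V.
  move=> pq'; apply/(mem_hull f_step); right.
  by exists v, l, p', q'; rewrite pq.
case: q => [|m q] in pq prefix *.
  by rewrite cats0 in pq; rewrite -pq -f_step lf.
case/lastP: p => [|p k] in pq prefix *; first exact: lf.
apply: (@card_ge2 _ _ m (linv k)).
- rewrite inE -[step _ m]/(walk _ [:: m]) -walk_cat.
  by apply: (prefix _ q); rewrite -catA.
- rewrite inE -cats1 walk_cat /= stepK.
  by apply: (prefix _ (k :: m :: q)); rewrite cat_rcons.
- have := reduced_fword (phi (letter l)); rewrite pq /reduced cat_rcons.
  by move=> /cat_sorted2[_] /= /andP[/eqP].
Qed.

(** Here C' stands for the core of the image and f for the inclusion of the old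
    vertices.  As both total excesses agree, all excess of C' sits at the images
    of the old vertices, in the old directions. *)
Lemma excess_subdivision (C : seq S) (C' : seq S') (Y : {set T' * bool}) :
  uniq C -> uniq C' -> {in C &, injective f} ->
  (forall c, c \in C -> f c \in C' /\ head @: star C c \subset star C' (f c)) ->
  leafless C -> leafless C' ->
  (\sum_(c <- C') excess (star C' c) = \sum_(c <- C) excess (star C c))%N ->
  (\sum_(c <- C') excess (star C' c :&: Y) <=
     \sum_(c <- C) excess (head @: star C c :&: Y))%N.
Proof.
move=> uC uC' injf sub lC lC' eqE.
have split_sum F : (\sum_(c <- C') F c =
    \sum_(c <- C) F (f c) + \sum_(c <- C' | c \notin [seq f c | c <- C]) F c)%N.
  rewrite (bigID (mem [seq f c | c <- C])) /=; congr (_ + _)%N.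
  rewrite -big_filter -[RHS](big_map f xpredT); apply: perm_big.
  apply: uniq_perm; rewrite ?filter_uniq ?map_inj_in_uniq // => c.
  rewrite mem_filter andb_idr // => /mapP[d Cd ->].
  by have [] := sub d Cd.
rewrite split_sum; move: eqE; rewrite split_sum.
have : (\sum_(c <- C' | c \notin [seq f c | c <- C]) excess (star C' c :&: Y) <=
        \sum_(c <- C' | c \notin [seq f c | c <- C]) excess (star C' c))%N.
  apply: leq_sum => c _; apply: leq_sub2r.
  exact: fintype.subset_leq_card (finset.subsetIl _ _).
suff : (\sum_(c <- C) (excess (star C' (f c) :&: Y) + excess (star C c)) <=
        \sum_(c <- C) (excess (head @: star C c :&: Y) + excess (star C' (f c))))%N.
  by rewrite !big_split /=; lia.
rewrite big_seq [leqRHS]big_seq; apply: leq_sum => c Cc.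
have [C'c subc] := sub c Cc; have := lC c Cc.
have := fintype.subset_leq_card subc; rewrite (card_imset _ head_inj) /excess.
have : (#|star C' (f c) :&: Y| <= #|head @: star C c :&: Y| +
         #|star C' (f c) :\: head @: star C c|)%N.
  rewrite -[leqLHS](finset.cardsID (head @: star C c)) leq_add //;
    apply: fintype.subset_leq_card; apply/fintype.subsetP => l; rewrite !inE.
    by case/andP=> /andP[_ ->] ->.
  by case/andP=> -> /andP[->].
rewrite finset.cardsD (finset.setIidPr subc) (card_imset _ head_inj).
have arith a b s s' : (a <= b + (s' - s) -> s <= s' -> 1 < s ->
    a - 2 + (s - 2) <= b - 2 + (s' - 2))%N by lia.
exact: arith.
Qed.

End Subdivision.

(** The only sizes for which the trivial bounds fail are three and three.  Then
    both summands are positive only if X = Y = head @: X, and the missing element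
    would be fixed by [head]. *)
Lemma excess_derangement (A : finType) (head : A -> A) (X Y : {set A}) :
  #|A| = 4%N -> injective head -> (forall l, head l <> l) ->
  (2 <= #|X|)%N -> (2 <= #|Y|)%N ->
  (excess (X :&: Y) + excess (head @: X :&: Y) <= excess X * excess Y)%N.
Proof.
move=> A4 headI derange X2 Y2; rewrite /excess.
have cardhX : #|head @: X| = #|X| by apply: card_imset.
have XYX : (#|X :&: Y| <= #|X|)%N by apply/fintype.subset_leq_card/finset.subsetIl.
have XYY : (#|X :&: Y| <= #|Y|)%N by apply/fintype.subset_leq_card/finset.subsetIr.
have hXYX : (#|head @: X :&: Y| <= #|X|)%N.
  by rewrite -cardhX; apply/fintype.subset_leq_card/finset.subsetIl.
have hXYY : (#|head @: X :&: Y| <= #|Y|)%N by apply/fintype.subset_leq_card/finset.subsetIr.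
have X4 : (#|X| <= 4)%N by rewrite -A4 max_card.
have Y4 : (#|Y| <= 4)%N by rewrite -A4 max_card.
have [/eqP X3|] := boolP (#|X| == 3%N); last by nia.
have [/eqP Y3|] := boolP (#|Y| == 3%N); last by nia.
suff : ~ (#|X :&: Y| = 3%N /\ #|head @: X :&: Y| = 3%N) by nia.
case=> XY hXY.
have XeqY : X = Y.
  have eX : X :&: Y = X by apply/eqP; rewrite eqEcard finset.subsetIl XY X3.
  by apply/eqP; rewrite eqEcard -{1}eX finset.subsetIr X3 Y3.
have hXeqY : head @: X = Y.
  have eX : head @: X :&: Y = head @: X.
    by apply/eqP; rewrite eqEcard finset.subsetIl hXY cardhX X3.
  by apply/eqP; rewrite eqEcard -{1}eX finset.subsetIr cardhX X3 Y3.
have : #|~: X| = 1%N by have := finset.cardsC X; rewrite X3 A4; lia.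
move=> /eqP/finset.cards1P[i cX].
have Xi : i \notin X by rewrite -finset.in_setC cX inE.
apply: (derange i); apply/eqP; rewrite -finset.in_set1 -cX finset.in_setC.
by rewrite XeqY -hXeqY finset.mem_imset // Xi.
Qed.
(** * The alternative *)

(** Letters are the elements of length one, so they are permuted; inverse letters
    go to inverse letters and no others do, so reduced words stay reduced. *)
Lemma isometry_letters (sigma : F2 -> F2) :
  {morph sigma : x y / x * y} -> injective sigma ->
  (forall u, flength (sigma u) = flength u) ->
  exists pi : bool * bool -> bool * bool,
    [/\ injective pi, forall l, sigma (letter l) = letter (pi l) &
        forall u, fword (sigma u) = [seq pi l | l <- fword u]].
Proof.
move=> sM sI slen.
have /choice[pi piE] : forall l, exists m, sigma (letter l) = letter m.
  move=> l; have := slen (letter l); rewrite /flength /=.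
  case sl: (fword (sigma (letter l))) => [|m [|]] // _.
  by exists m; apply: fword_inj.
have piI : injective pi.
  by move=> l m lm; apply: letter_inj; apply: sI; rewrite !piE lm.
exists pi; split=> // u; rewrite (fword_morph u sM).
have piV l : pi (linv l) = linv (pi l).
  by apply: letter_inj; rewrite letterV -!piE letterV morphV.
have -> : flatten [seq fword (sigma (letter l)) | l <- fword u] = map pi (fword u).
  by elim: (fword u) => //= l w ->; rewrite piE.
rewrite reduce_id // /reduced sorted_map.
have := reduced_fword u; apply: sub_sorted => l m /=.
by rewrite -piV; apply: contraNneq => /piI->.
Qed.

Section Alternative.
Variables (phi : F2 -> F2) (head : bool * bool -> bool * bool).
Hypotheses (phiM : {morph phi : x y / x * y}) (phiI : injective phi).
Hypotheses (head_inj : injective head) (derange : forall l, head l <> l)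
  (phi_head : forall l, exists w, fword (phi (letter l)) = head l :: w).

Let graph := cosets bool.

Lemma image_phi_inj : injective (fun A : graph => phi @` A : graph).
Proof.
by move=> A B AB; apply/funext => x; rewrite -(image_inj phiI) AB image_inj.
Qed.

Lemma step_image (A : graph) l :
  (phi @` (step A l) : graph) = walk (phi @` A : graph) (fword (phi (letter l))).
Proof.
have phiV := morphV phiM.
rewrite walk_cosets; apply/seteqP; split=> [_ [x Ax <-]|y [x Ax xy]].
  by exists (x * (letter l)^-1) => //; rewrite phiM phiV.
by exists (x * letter l); rewrite ?phiM ?xy ?mulgVK //= mulgK.
Qed.

Lemma onto_image (V : seq graph) (A B : graph) (y : F2) (H : graph) :
  convex V -> H 1 -> H \in V -> A \in V -> B \in V ->
  walk (phi @` A : graph) (fword y) = phi @` B ->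
  exists2 x, phi x = y & walk A (fword x) = B.
Proof.
move=> cV H1 VH VA VB yAB.
have [z zA] := cV.1 _ _ VH VA.
have Az : A z by rewrite -zA walk_cosets /= mulgV.
have : (phi @` B) (phi z * y).
  by rewrite -yAB walk_cosets /= mulgK; exists z.
case=> b Bb bE; exists (z^-1 * b).
  by rewrite phiM (morphV phiM) bE mulKg.
apply: image_phi_inj; rewrite [LHS](f_walk phiM step_image).
by rewrite phiM (morphV phiM) bE mulKg.
Qed.

(** The cores are taken inside convex sets that contain the base points H, K and
    phi(H), because the intersection is based at a pair of base points, which may
    lie outside the cores. *)
Theorem hanna_neumann_alternative (H K : set F2) :
  is_subgroup H -> finitely_generated H -> H <> [set 1] ->
  is_subgroup K -> finitely_generated K -> K <> [set 1] ->
  hanna_neumann H K \/ hanna_neumann (phi @` H) K.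
Proof.
move=> sH fH nH sK fK nK.
have core_of (L : set F2) (V : seq graph) : is_subgroup L -> L <> [set 1] ->
    uniq V -> convex V -> (L : graph) \in V -> exists C, is_core V C.
  move=> sL nL uV cV VL; have [L1 _ _] := sL.
  have [x [x1 Lx]] : exists x, x <> 1 /\ L x.
    apply: contrapT => noloop; apply: nL; apply/seteqP; split=> [x Lx|_ ->] //.
    by apply: contrapT => x1; apply: noloop; exists x.
  by apply: (exists_core uV cV VL x1); rewrite -{1}(stab_cosets sL) in Lx.
have [V1 [uV1 cV1 VH]] := exists_convex_cosets sH fH.
have [V2 [uV2 cV2 VK]] := exists_convex_cosets sK fK.
have [C1 core1] := core_of H V1 sH nH uV1 cV1 VH.
have [C2 core2] := core_of K V2 sK nK uV2 cV2 VK.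
pose H' := phi @` H; have [H1 HM HV] := sH.
have sH' : is_subgroup H'.
  split=> [|_ _ [x Hx <-] [y Hy <-]|_ [x Hx <-]].
  - by exists 1 => //; apply: morph1.
  - by exists (x * y); [apply: HM | rewrite phiM].
  - by exists (x^-1); [apply: HV | apply: morphV].
have nH' : H' <> [set 1].
  move=> H'1; apply: nH; apply/seteqP; split=> [x Hx|_ ->] //.
  apply: phiI; rewrite (morph1 phiM).
  by have : H' (phi x) by [exists x]; rewrite H'1.
pose f (A : graph) : graph := phi @` A.
pose V1' : seq graph := hull phi f V1.
have cV1' : convex V1'.
  apply: (convex_hull phiM step_image cV1) => A B y VA VB.
  exact: (onto_image cV1 H1 VH).
have VH' : (H' : graph) \in V1'.
  by apply/(mem_hull step_image); left; exists H.
have uV1' : uniq V1' := undup_uniq _.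
have [C1' core1'] := core_of H' V1' sH' nH' uV1' cV1' VH'.
have subhull : {subset hull phi f C1 <= C1'}.
  apply: (core_max core1'); first exact: (hullS step_image (core_sub core1)).
  exact: (leafless_hull step_image head_inj phi_head (core_leafless core1)).
have [h [rkH hE]] := rank_core false cV1 VH core1.
have [k [rkK kE]] := rank_core false cV2 VK core2.
have [h' [rkH' hE']] := rank_core false cV1' VH' core1'.
rewrite !stab_cosets // in rkH rkK rkH'.
have eqh : h' = h := has_rank_inj rkH' (has_rank_image phiM phiI rkH).
subst h'.
have sum_le (c2 : graph) : c2 \in C2 ->
    (\sum_(c <- C1') excess (star C1' c :&: star C2 c2) <=
     \sum_(c <- C1) excess (head @: star C1 c :&: star C2 c2))%N.
  move=> _; apply: (excess_subdivision head_inj (f := f)).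
  - exact: core_uniq core1.
  - exact: core_uniq core1'.
  - by move=> A B _ _; apply: image_phi_inj.
  - move=> c C1c; split.
      by apply: subhull; apply/(mem_hull step_image); left; exists c.
    apply: fintype.subset_trans (starS _ subhull).
    exact: (star_hull step_image phi_head C1c).
  - exact: core_leafless core1.
  - exact: core_leafless core1'.
  - by apply: (@addIn 2); rewrite hE hE'.
have [m [rkm mE]] := rank_pullback false uV1 uV2 cV1 cV2 VH VK core1 core2.
have [m' [rkm' mE']] := rank_pullback false uV1' uV2 cV1' cV2 VH' VK core1' core2.
rewrite !stab_cosets // in rkm rkm'.
have {mE'} : (m'.*2 <= \sum_(c1 <- C1) \sum_(c2 <- C2)
    excess (head @: star C1 c1 :&: star C2 c2) + 2)%N.
  apply: leq_trans mE' _; rewrite leq_add2r exchange_big [leqRHS]exchange_big /=.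
  by rewrite big_seq [leqRHS]big_seq; apply: leq_sum.
have : (\sum_(c1 <- C1) \sum_(c2 <- C2) excess (star C1 c1 :&: star C2 c2) +
    \sum_(c1 <- C1) \sum_(c2 <- C2)
      excess (head @: star C1 c1 :&: star C2 c2) <=
    (\sum_(c <- C1) excess (star C1 c)) * (\sum_(c <- C2) excess (star C2 c)))%N.
  rewrite big_distrl -big_split big_seq [leqRHS]big_seq /=; apply: leq_sum => c1 C1c.
  rewrite big_distrr -big_split big_seq [leqRHS]big_seq /=; apply: leq_sum => c2 C2c.
  apply: excess_derangement => //; first by rewrite card_prod card_bool.
    exact: (core_leafless core1).
  exact: (core_leafless core2).
case: h k hE kE rkH rkH' rkK {hE'} => [|h] [|k] hE kE rkH rkH' rkK; try lia.
have {hE} -> : (\sum_(c <- C1) excess (star C1 c) = h.*2)%N.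
  by apply: (@addIn 2); rewrite hE doubleS addn2.
have {kE} -> : (\sum_(c <- C2) excess (star C2 c) = k.*2)%N.
  by apply: (@addIn 2); rewrite kE doubleS addn2.
have bound n : (n <= h * k + 1)%N ->
  (n%:Z - 1 <= (h.+1%:Z - 1) * (k.+1%:Z - 1))%R by nia.
move: mE {sum_le}.
move: (\sum_(c1 <- C1) \sum_(c2 <- C2) _)%N (\sum_(c1 <- C1) \sum_(c2 <- C2) _)%N.
move=> E' E mE EE' mE'.
have [small|big] := leqP E (h * k).*2%N.
  by left; exists m, h.+1, k.+1; split=> //; apply: bound; lia.
right; exists m', h.+1, k.+1; split=> //; apply: bound.
have : (h.*2 * k.*2 = (h * k) * 4)%N by lia.
by lia.
Qed.

End Alternative.

Theorem theorem1 (sigma tau : {multiplicative F2 -> F2}) (wa wb : F2) :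
  bijective sigma ->
  (forall u : F2, flength (sigma u) = flength u) ->
  (forall w : F2, w <> 1 -> sigma w <> w) ->
  reduced (fword a ++ fword wa ++ fword a) ->
  reduced (fword b ++ fword wb ++ fword b) ->
  tau a = a * wa * a ->
  tau b = b * wb * b ->
  injective tau ->
  forall H K : set F2,
    is_subgroup H -> finitely_generated H -> H <> [set 1] ->
    is_subgroup K -> finitely_generated K -> K <> [set 1] ->
    hanna_neumann H K \/ hanna_neumann (sigma @` (tau @` H)) K.
Proof.
move=> /bij_inj sI slen sfix reda redb ta tb tI H K sH fH nH sK fK nK.
have [pi [piI piE piW]] := isometry_letters gmulfM sI slen.
rewrite image_comp; apply: (@hanna_neumann_alternative (sigma \o tau) pi) => //.
- by move=> x y /=; rewrite !gmulfM.
- exact: inj_comp sI tI.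
- move=> l ll; apply: (sfix (letter l)) => //.
  by rewrite piE ll.
suff tau_head l : exists w, fword (tau (letter l)) = l :: w.
  by move=> l; have [w lw] := tau_head l; exists (map pi w); rewrite piW lw.
have end_letters t (w : F2) : reduced (fword (fgen t) ++ fword w ++ fword (fgen t)) ->
    tau (fgen t) = fgen t * w * fgen t ->
    forall s, exists w', fword (tau (letter (t, s))) = (t, s) :: w'.
  move=> red_w tauE s.
  have word_tau : fword (tau (fgen t)) = (t, false) :: rcons (fword w) (t, false).
    rewrite -cats1 -[RHS](reduce_id red_w) tauE catA.
    exact: reduce_catl.
  case: s; last by eexists; apply: word_tau.
  have tauV : tau (letter (t, true)) = (tau (fgen t))^-1.
    by rewrite (letterV (t, false)) (morphV (@gmulfM _ _ tau)).
  rewrite tauV /= word_tau /winv -rcons_cons map_rcons rev_rcons.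
  by eexists.
by case: l => -[] s; [apply: end_letters redb tb s | apply: end_letters reda ta s].
Qed.
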